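(* Fix one of the four UETS settings (sUETS or mUETS, each either non-preemptive or preemptive). Let $\mathrm{ALG}$ be a $\rho$-competitive online algorithm for that setting in which all jobs are released at time $0$. Then the IGNORE strategy using $\mathrm{ALG}$ is a $(2\rho+1)$-competitive online algorithm for the same setting in which jobs have arbitrary release times.
   Context: UETS model: there is a finite set $J$ of jobs and $m\ge 2$ identical machines. A monotone subadditive setup-time function $c:2^J\to\mathbb{R}_{\ge0}$ is known (monotone: $c(X)\le c(Y)$ for $X\subseteq Y$; subadditive: $c(X)+c(Y)\ge c(X\cup Y)$ for disjoint $X,Y$). Each job $j$ has an execution time $p_j\ge 0$, unknown to an online algorithm until $j$ completes; $p(X)=\sum_{j\in X}p_j$. A batch is a set of jobs that are not completed and not currently assigned elsewhere. In sUETS each batch is assigned to a single machine, which processes a batch $X$ in time $c(X)+p(X)$. In mUETS a batch $X$ may be assigned to $k\ge1$ machines; each of them incurs setup time $c(X)$ and the jobs are executed first-come first-served among them, the batch finishing between $c(X)+p(X)/k$ and $c(X)+p(X)/k+\max_{j\in X}p_j$ after its start. Non-preemptive: an assigned batch is processed to completion. Preemptive: processing of a batch can be halted; if a batch $X$ on $k$ machines is preempted $t$ time units after its start, the machines become free after at most $c(X)+\max_{j\in X}p_j$ further time units, the set $X'$ of completed jobs of $X$ satisfies $c(X)+p(X')/k+\max_{j\in X}p_j\ge t$, completed jobs need not be reprocessed, and uncompleted jobs may be regrouped into new batches (incurring setup again). The makespan is the time at which all jobs are completed; the optimal (offline) makespan is computed with full knowledge of all execution times (and release times). An online algorithm is $\rho$-competitive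 if on every instance its makespan is at most $\rho$ times the optimal makespan. In the version with release times, each job $j$ has a release time $r_j\ge 0$; the job's existence is unknown to an online algorithm before $r_j$ and it cannot be processed before $r_j$. The IGNORE strategy: machines stay idle until some set $S$ of jobs has been released; it then immediately computes a subschedule for $S$ by running $\mathrm{ALG}$ on $S$ as if all jobs of $S$ were released at that moment, and jobs released during this subschedule are ignored until all jobs of $S$ are completed; then it computes in the same way a subschedule for all jobs released during the previous subschedule, and if there are none the machines become idle until new jobs arrive; this repeats. *)

(* Defs.v *)
From Stdlib Require List.
From HB Require Import structures.
From mathcomp Require Import all_boot all_order all_algebra.
From mathcomp Require Import finmap.
From mathcomp Require Import classical_sets reals.

Set Implicit Arguments.
Unset Strict Implicit.
Unset Printing Implicit Defensive.

Import Order.TTheory GRing.Theory Num.Theory.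

Local Open Scope fset_scope.
Local Open Scope ring_scope.

(* Job names.  An instance uses a finite set of them; having one infinite
   supply lets one algorithm be run on all instances. *)
Notation job := nat (only parsing).

Record instance (R : realType) := Instance {
  jobs : {fset job};
  setup : {fset job} -> R;
  ptime : job -> R;
  rtime : job -> R }.

(* The four settings: mUETS if multi, sUETS otherwise. *)
Record setting := Setting { multi : bool; preemptive : bool }.

Section Instances.
Context {R : realType}.
Implicit Type I : instance R.

Definition setup_nonneg I :=
  forall X, X `<=` jobs I -> 0 <= setup I X.

Definition setup_monotone I :=
  forall X Y, X `<=` Y -> Y `<=` jobs I -> setup I X <= setup I Y.

Definition setup_subadditive I :=
  forall X Y, X `<=` jobs I -> Y `<=` jobs I -> [disjoint X & Y]%fset ->
    setup I (X `|` Y) <= setup I X + setup I Y.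

Definition uets_instance I :=
  [/\ setup_nonneg I, setup_monotone I, setup_subadditive I,
      forall j, j \in jobs I -> 0 <= ptime I j
    & forall j, j \in jobs I -> 0 <= rtime I j].

Definition all_released_at_0 I := forall j, j \in jobs I -> rtime I j = 0.

Definition psum I (X : {fset job}) : R := \sum_(j <- X) ptime I j.

Definition pmax I (X : {fset job}) : R :=
  \big[Num.max/0]_(j <- X) ptime I j.

(* First-come first-served processing of the queue s: loads is the sorted list
   of the times at which the machines can take their next job.  The result
   lists the jobs with their completion times. *)
Fixpoint fcfs (p : job -> R) (loads : seq R) (s : seq job) : seq (job * R) :=
  match s, loads with
  | j :: s', l :: loads' =>
      (j, l + p j) :: fcfs p (sort <=%R (l + p j :: loads')) s'
  | _, _ => [::]
  end.

End Instances.

Section Batches.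
Context {R : realType} {m : nat}.
Implicit Types (I : instance R) (st : setting).

(* One execution of a batch.  bcomp lists the jobs that get completed in it,
   with their completion times; bend is the time at which the machines of the
   batch become free.  All times are absolute. *)
Record batch := Batch {
  bjobs : {fset job};
  bmach : {set 'I_m};
  bstart : R;
  bcomp : seq (job * R);
  bend : R;
  bhalted : bool }.

Definition bdone (b : batch) : {fset job} :=
  [fset j in bjobs b | j \in unzip1 (bcomp b)].

Definition batch_shape st (X : {fset job}) (M : {set 'I_m}) : bool :=
  [&& X != fset0, M != finset.set0 & multi st || (#|M| == 1)%N].

(* A batch is a set, so the order in which its jobs are served is not
   determined by the batch.  All its machines stay occupied until its last job
   is completed; on a single machine this is at time bstart + c(X) + p(X). *)
Definition completed_execution I (b : batch) : Prop :=
  exists s : seq job,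
    [/\ perm_eq s (bjobs b),
        bcomp b = fcfs (ptime I)
                    (nseq #|bmach b| (bstart b + setup I (bjobs b))) s,
        bend b = \big[Num.max/bstart b]_(e <- bcomp b) e.2
      & bhalted b = false].

(* b' is a possible outcome of halting b at (absolute) time t.  Jobs completed
   by time t stay completed; between t and the time bend b' at which the
   machines become free further jobs may or may not be completed.  Until bend b'
   the uncompleted jobs remain assigned to the batch. *)
Definition halted_execution I (t : R) (b b' : batch) : Prop :=
  exists X' : {fset job},
    let X := bjobs b in
    [/\ b' = Batch X (bmach b) (bstart b)
               [seq e <- bcomp b | e.1 \in X'] (bend b') true,
        X' `<=` X,
        forall e, e \in bcomp b ->
          (e.2 <= t -> e.1 \in X') /\ (e.1 \in X' -> e.2 <= bend b'),
        t <= bend b' <= Num.min (bend b) (t + (setup I X + pmax I X))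
      & t - bstart b <= setup I X + psum I X' / #|bmach b|%:R + pmax I X].

Definition offline_batch st I (b : batch) : Prop :=
  [/\ batch_shape st (bjobs b) (bmach b),
      bjobs b `<=` jobs I,
      forall j, j \in bjobs b -> rtime I j <= bstart b
    & completed_execution I b \/
      (preemptive st /\ exists (b0 : batch) (t : R),
         [/\ completed_execution I b0, bstart b0 <= t <= bend b0
           & halted_execution I t b0 b])].

Definition precedes (b b' : batch) : Prop :=
  bend b <= bstart b' /\ [disjoint bdone b & bjobs b']%fset.

(* Two batches that share a machine or a job do not overlap in time, and the
   jobs of the later one have not been completed in the earlier one. *)
Definition compatible (b b' : batch) : Prop :=
  [\/ [disjoint bmach b & bmach b']%bool /\ [disjoint bjobs b & bjobs b']%fset,
      precedes b b' | precedes b' b].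

Definition offline_schedule st I (sigma : seq batch) : Prop :=
  [/\ forall b, List.In b sigma -> offline_batch st I b,
      List.ForallOrdPairs compatible sigma
    & forall j, j \in jobs I ->
        exists b, List.In b sigma /\ j \in bdone b].

Definition makespan (sigma : seq batch) : R :=
  \big[Num.max/0]_(b <- sigma) \big[Num.max/0]_(e <- bcomp b) e.2.

Definition opt st I : R :=
  inf [set makespan sigma | sigma in offline_schedule st I]%classic.

(* Wait (Some t): wait for the next observation, at the latest until time t. *)
Inductive command :=
| Start of {fset job} & {set 'I_m}
| Preempt of 'I_m
| Wait of option R.

(* Observed D F N w: the jobs in D have been completed (with their execution
   times), the machines in F have become free, the jobs in N have been
   released, and w tells whether the algorithm's own timer has expired. *)
Inductive event :=
| Started of {fset job} & {set 'I_m}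
| Preempted of 'I_m
| Observed of seq (job * R) & {set 'I_m} & {fset job} & bool.

(* Time-stamped events, the most recent one first. *)
Definition history := seq (R * event).

(* The first argument is the setup-time function, the second one what has been
   observed up to now. *)
Definition algorithm := ({fset job} -> R) -> history -> command.

Record config := Config {
  now : R;
  hist : history;
  released : {fset job};
  completed : {fset job};
  running : seq batch }.

Definition init I : config :=
  let N := [fset j in jobs I | rtime I j == 0] in
  Config 0 [:: (0, Observed [::] finset.set0 N false)] N fset0 [::].

(* The algorithm knows c only on sets of jobs that have been released. *)
Definition known_setup I (cfg : config) : {fset job} -> R :=
  fun X => setup I (X `&` released cfg).

Definition can_start st (cfg : config) (X : {fset job}) (M : {set 'I_m}) :=
  [&& batch_shape st X M, X `<=` released cfg,
      [disjoint X & completed cfg]%fset,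
      all (fun b => [disjoint X & bjobs b]%fset) (running cfg)
    & all (fun b => [disjoint M & bmach b]%bool) (running cfg)].

Definition upcoming I (cfg : config) (w : option R) : seq R :=
  [seq e.2 | e <- flatten [seq bcomp b | b <- running cfg]
           & e.1 \notin completed cfg]
  ++ [seq bend b | b <- running cfg]
  ++ [seq rtime I j | j <- jobs I `\` released cfg]
  ++ seq_of_opt w.

(* Everything that happens at time t is observed simultaneously. *)
Definition advance I (cfg : config) (w : option R) (t : R) : config :=
  let D := [fset j in jobs I | (j \notin completed cfg) &&
              has (fun b => (j, t) \in bcomp b) (running cfg)] in
  let F := (\bigcup_(b <- running cfg | bend b == t) bmach b)%SET in
  let N := [fset j in jobs I | (j \notin released cfg) && (rtime I j == t)] in
  Config t
    ((t, Observed [seq (j, ptime I j) | j <- D] F N (w == Some t)) :: hist cfg)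
    (released cfg `|` N) (completed cfg `|` D)
    [seq b <- running cfg | bend b != t].

(* cfg' ranges over the configurations that may come next; there is none if the command of the
   algorithm is not admissible. *)
Definition step st I (A : algorithm) (cfg cfg' : config) : Prop :=
  match A (known_setup I cfg) (hist cfg) with
  | Start X M =>
      can_start st cfg X M /\
      exists b, [/\ completed_execution I b,
        bjobs b = X, bmach b = M, bstart b = now cfg
      & cfg' = Config (now cfg) ((now cfg, Started X M) :: hist cfg)
                 (released cfg) (completed cfg) (b :: running cfg)]
  | Preempt i =>
      preemptive st /\
      exists r1 b r2 b', [/\ running cfg = r1 ++ b :: r2,
        i \in bmach b, bhalted b = false, halted_execution I (now cfg) b b'
      & cfg' = Config (now cfg) ((now cfg, Preempted i) :: hist cfg)
                 (released cfg) (completed cfg) (r1 ++ b' :: r2)]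
  | Wait w =>
      exists t, [/\ now cfg <= t, t \in upcoming I cfg w,
        all (fun u => t <= u) (upcoming I cfg w)
      & cfg' = advance I cfg w t]
  end.

Definition finished I (cfg : config) : bool := jobs I `<=` completed cfg.

(* However the execution continues from the given configuration, after finitely
   many steps all jobs are completed, at a time that is at most B. *)
Inductive finishes_by st I (A : algorithm) (B : R) : config -> Prop :=
| FinishedBy cfg :
    finished I cfg -> now cfg <= B -> finishes_by st I A B cfg
| StepBy cfg :
    (exists cfg', step st I A cfg cfg') ->
    (forall cfg', step st I A cfg cfg' -> finishes_by st I A B cfg') ->
    finishes_by st I A B cfg.

Definition competitive_on (P : instance R -> Prop) st (A : algorithm) (rho : R)
    : Prop :=
  forall I, uets_instance I -> P I ->
    finishes_by st I A (rho * opt st I) (init I).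

Definition competitive := competitive_on (fun=> True).

Definition competitive_at_0 := competitive_on all_released_at_0.

Record subschedule := Subschedule {
  sstart : R;
  sjobs : {fset job};
  stodo : {fset job};    (* the jobs of sjobs that are not completed *)
  sbacklog : {fset job}; (* the jobs released since sstart *)
  shist : history        (* what ALG has observed, with time 0 at sstart *) }.

(* None: the machines are idle, and there is no released uncompleted job. *)
Definition begin_subschedule (t : R) (S : {fset job}) : option subschedule :=
  if S == fset0 then None
  else Some (Subschedule t S S fset0
               [:: (0, Observed [::] finset.set0 S false)]).

Definition ignore_update (te : R * event) (o : option subschedule)
    : option subschedule :=
  let: (t, e) := te in
  match o, e with
  | None, Observed _ _ N _ => begin_subschedule t N
  | None, _ => None
  | Some (Subschedule t0 T U W h), Observed D F N w =>
      let U' := [fset j in U | j \notin unzip1 D] in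
      if U' == fset0 then begin_subschedule t (W `|` N)
      else
        (* ALG must not notice an observation that consists of releases only *)
        let hidden := [&& nilp D, F == finset.set0 & ~~ w] in
        Some (Subschedule t0 T U' (W `|` N)
                (if hidden then h
                 else (t - t0, Observed D F fset0 w) :: h))
  | Some (Subschedule t0 T U W h), _ =>
      Some (Subschedule t0 T U W ((t - t0, e) :: h))
  end.

Definition ignore (A : algorithm) : algorithm := fun c h =>
  match foldr ignore_update None h with
  | None => Wait None
  | Some s =>
      match A (fun X => c (X `&` sjobs s)) (shist s) with
      | Wait w => Wait (omap (+%R (sstart s)) w)
      | cmd => cmd
      end
  end.

End Batches.

Arguments batch : clear implicits.
Arguments command : clear implicits.
Arguments event : clear implicits.
Arguments history : clear implicits.
Arguments algorithm : clear implicits.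
Arguments config : clear implicits.
Arguments subschedule : clear implicits.
Arguments opt {R} m st I.

(* Main.v *)
(* Let o be the optimum.  Every subschedule of IGNORE lasts at most rho * o: an
   offline schedule stays one when the jobs outside S are left out and all
   release times are set to 0, so the optimum of S alone is at most o.  A
   subschedule with a predecessor contains a job released after the start of
   that predecessor, which hence started by time o; so every subschedule starts
   by time o + rho * o and ends by time (2 * rho + 1) * o.  That ALG really
   meets its bound inside IGNORE is a simulation argument: up to a time shift,
   the run on I during a subschedule is a run of ALG on S, interrupted only by
   hidden releases. *)

From HB Require Import structures.
Require Import Defs.
From mathcomp Require Import all_boot all_order all_algebra finmap.
From mathcomp Require Import boolp classical_sets reals.

Set Implicit Arguments.
Unset Strict Implicit.
Unset Printing Implicit Defensive.

Import Order.TTheory GRing.Theory Num.Theory.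

Local Open Scope fset_scope.
Local Open Scope ring_scope.

(** * List scheduling *)

(** With fewer jobs, a batch halted at the same time may violate the lower bound on its completed
    work; so no restricted batch stays halted. That it still does not end later rests, on several
    machines, on the absence of anomalies in list scheduling. [finishes_by] asks both that a step
    exists and that every step leads on. So progress of [A] has to be carried over to [ignore A],
    and each outcome the adversary may choose against [ignore A] pulled back to one against [A];
    time shifts, being invertible, do both. A hidden release is a step without counterpart in the
    run of [A], so the induction on that run needs an inner one on the number of unreleased jobs.
    Finally, [ignore] switches subschedules on seeing completions only, yet all machines must be
    free by then; the invariant on running batches supplies this. *)

HB.instance Definition _ (R : realType) (m : nat) :=
  gen_eqMixin (batch R m).

Lemma InP (T : eqType) (x : T) (s : seq T) : List.In x s <-> x \in s.
Proof.
elim: s => [|y s IHs] //=; rewrite !inE; split.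
  by case=> [->|/IHs ->]; rewrite ?eqxx ?orbT.
by case/orP=> [/eqP ->|/IHs]; [left|right].
Qed.

Section ListScheduling.
Context {R : realType}.
Implicit Types (p : nat -> R) (u v : seq R) (s : seq nat).

Lemma map_fst_fcfs p u s : u != [::] -> unzip1 (fcfs p u s) = s.
Proof.
elim: s u => [|j s IHs] [|l u] //= _; rewrite IHs // -size_eq0.
by rewrite size_sort.
Qed.

Lemma fcfs_ge p u s a :
    (forall j, j \in s -> 0 <= p j) -> (forall l, l \in u -> a <= l) ->
  forall e, e \in fcfs p u s -> a + p e.1 <= e.2.
Proof.
elim: s u => [|j s IHs] [|l u] //= p_ge0 u_ge e.
have al : a <= l by rewrite u_ge ?mem_head.
have pj : 0 <= p j by rewrite p_ge0 ?mem_head.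
rewrite inE => /predU1P[->|] /=; first by rewrite lerD2r.
apply: IHs => [i si|x]; first by rewrite p_ge0 // inE si orbT.
rewrite mem_sort inE => /predU1P[->|ux]; first by rewrite ler_wpDr.
by rewrite u_ge // inE ux orbT.
Qed.

Lemma fcfs_shift p (d : R) u s :
  fcfs p (map (+%R d) u) s = [seq (e.1, d + e.2) | e <- fcfs p u s].
Proof.
elim: s u => [|j s IHs] [|l u] //=; rewrite -IHs -addrA.
rewrite -[d + (l + p j) :: _]/(map (+%R d) (l + p j :: u)) sort_map.
by congr (_ :: fcfs _ (map _ (sort _ _)) _); apply/funext=> x;
  apply/funext=> y; rewrite /= lerD2l.
Qed.

(* [u] has at least as many loads below any level as [v]: for sorted lists of
   the same size this is pointwise domination, but it is insensitive to sorting. *)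
Definition earlier u v : Prop :=
  size u = size v /\
  forall x, (count (fun l => (l <= x)%R) v <= count (fun l => (l <= x)%R) u)%N.

Lemma earlier_sort u v : earlier u v -> earlier (sort <=%R u) (sort <=%R v).
Proof.
case=> sz ct; split; rewrite ?size_sort // => x.
by rewrite !(permP (permEl (perm_sort _ _))).
Qed.

Lemma earlier_head l u k v : sorted <=%R (l :: u) -> earlier (l :: u) (k :: v) ->
  l <= k.
Proof.
move=> srt [_ /(_ k)]; rewrite [X in (X <= _)%N]/= lexx leNgt => ct.
apply/negP => kl; suff : count (fun x => x <= k) (l :: u) = 0%N.
  by move=> c0; rewrite c0 in ct.
apply/eqP; rewrite -leqn0 leqNgt -has_count -all_predC; apply/allP => x.
rewrite inE /= -ltNge => /predU1P[-> //|xu]; apply: lt_le_trans kl _.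
by move: srt => /=; rewrite path_sortedE; [case/andP => /allP/(_ _ xu)|exact: le_trans].
Qed.

Lemma count_sorted0 l u x : sorted <=%R (l :: u) -> x < l ->
  count (fun y => y <= x) u = 0%N.
Proof.
move=> srt xl; apply/eqP; rewrite -leqn0 leqNgt -has_count -all_predC.
apply/allP => y yu /=; rewrite -ltNge; apply: lt_le_trans xl _.
by move: srt => /=; rewrite path_sortedE; [case/andP => /allP/(_ _ yu)|exact: le_trans].
Qed.

(** Below level [k] nothing of [k + q :: v] is counted. From [k] on, both old heads are counted and
    cancel, so the tails compare, and [l <= k] orders the new heads. *)
Lemma earlier_step l u k v q : sorted <=%R (l :: u) -> sorted <=%R (k :: v) ->
  earlier (l :: u) (k :: v) -> 0 <= q -> earlier (l + q :: u) (k + q :: v).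
Proof.
move=> su sv e q0; have lk := earlier_head su e; case: e => [sz ct].
split=> // x; have := ct x; rewrite /=.
case: (leP k x) => kx; last first.
  rewrite (count_sorted0 sv kx) (_ : k + q <= x = false) //.
  by apply/negbTE; rewrite -ltNge (lt_le_trans kx) // lerDl.
rewrite (le_trans lk kx) leq_add2l => cuv; apply: leq_add => //.
by case: (leP (k + q) x) => // kq; rewrite (le_trans _ kq) // lerD2r.
Qed.

Lemma earlier_skip u k v q : earlier u (k :: v) -> 0 <= q ->
  earlier u (k + q :: v).
Proof.
move=> [sz ct] q0; split=> // x; apply: leq_trans (ct x) => /=.
rewrite leq_add2r; case: (leP (k + q) x) => // kq.
by rewrite (le_trans _ kq) // lerDl.
Qed.

(* Jobs on identical machines without precedence constraints: list scheduling
   has no anomalies, i.e. leaving out jobs delays no other job. *)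
Lemma fcfs_filter p (P : pred nat) u v s :
    (forall j, j \in s -> 0 <= p j) -> sorted <=%R u -> sorted <=%R v ->
    earlier u v ->
  forall e, e \in fcfs p u (filter P s) ->
  exists2 e', e' \in fcfs p v s & e'.1 = e.1 /\ e.2 <= e'.2.
Proof.
elim: s u v => [|j s IHs] u v //= p_ge0 su sv uv e.
have srt := sort_sorted (@le_total _ R).
have pj : 0 <= p j by rewrite p_ge0 ?mem_head.
have {}p_ge0 i : i \in s -> 0 <= p i by move=> si; rewrite p_ge0 // inE si orbT.
case: v => [|k v] in sv uv *.
  by case: u => [|l u] in su uv *; [case: ifP => //=; case: [seq _ <- _ | _] | case: uv].
have [_|_] := ifP => eu.
  case: u => [|l u] //= in su uv eu *; have lk := earlier_head su uv.
  move: eu; rewrite inE => /predU1P[->|eu].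
    by exists (j, k + p j); rewrite ?mem_head //= lerD2r.
  have [||||e' e'v] := IHs _ (sort <=%R (k + p j :: v)) _ _ _ _ e eu => //.
    by apply/earlier_sort/earlier_step.
  by exists e'; rewrite // inE e'v orbT.
(* The job is left out on one side, so only the other list of loads moves, and it moves later. *)
have [||e' e'v] := IHs _ (sort <=%R (k + p j :: v)) p_ge0 su _ _ e eu => //.
  rewrite -[u](sorted_sort _ su); last exact: le_trans.
  by apply/earlier_sort/earlier_skip.
by exists e'; rewrite // inE e'v orbT.
Qed.

Lemma sorted_nseq k (a : R) : sorted <=%R (nseq k a).
Proof. by case: k => //; elim=> //= k IHk; rewrite lexx. Qed.

Lemma earlier_nseq k (a b : R) : a <= b -> earlier (nseq k a) (nseq k b).
Proof.
move=> ab; split; rewrite ?size_nseq // => x; rewrite !count_nseq leq_mul2r.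
by case: (leP b x) => [/(le_trans ab)->|]; rewrite ?orbT.
Qed.

Lemma bigmax_le_mem (T : eqType) (x0 B : R) (s : seq T) (F : T -> R) :
  (\big[Num.max/x0]_(i <- s) F i <= B) <->
  (x0 <= B /\ forall i, i \in s -> F i <= B).
Proof.
elim: s => [|y s IHs]; first by rewrite big_nil; split=> [|[]].
rewrite big_cons ge_max; split=> [/andP[yB /IHs[x0B sB]]|[x0B sB]].
  by split=> // i; rewrite inE => /predU1P[->|/sB].
rewrite sB ?mem_head //=; apply/IHs; split=> // i si.
by rewrite sB // inE si orbT.
Qed.

Lemma bigmax_attained (T : eqType) (x0 : R) (s : seq T) (F : T -> R) :
  s != [::] -> (forall i, i \in s -> x0 <= F i) ->
  exists2 i, i \in s & \big[Num.max/x0]_(i <- s) F i = F i.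
Proof.
elim: s => [|y s IHs] // _ ge0; rewrite big_cons.
have [->|s_n0] := eqVneq s [::].
  by exists y; rewrite ?mem_head // big_nil max_l // ge0 ?mem_head.
have [i si|i si ->] := IHs s_n0; first by rewrite ge0 // inE si orbT.
case: leP => _; first by exists i; rewrite // inE si orbT.
by exists y; rewrite ?mem_head.
Qed.

End ListScheduling.

(** * The offline optimum *)

Section Optimum.
Context {R : realType} {m : nat}.
Implicit Types (I : instance R) (b : batch R m) (S : {fset nat}).

Definition subinstance I S : instance R :=
  Instance S (setup I) (ptime I) (fun=> 0).

Lemma uets_subinstance I S :
  uets_instance I -> S `<=` jobs I -> uets_instance (subinstance I S).
Proof.
move=> [c0 cm cs p0 _] SI; split=> //= [X XS|X Y XY YS|X Y XS YS|j jS].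
- exact/c0/(fsubset_trans XS).
- exact/cm/(fsubset_trans YS).
- by apply: cs; [exact: fsubset_trans XS SI|exact: fsubset_trans YS SI].
- exact/p0/(fsubsetP SI).
Qed.

Lemma loads_neq0 (M : {set 'I_m}) (a : R) :
  M != finset.set0 -> nseq #|M| a != [::].
Proof. by rewrite -card_gt0; case: #|M|. Qed.

Lemma map_fst_filter (T : Type) (P : pred T) (s : seq (T * R)) :
  unzip1 [seq e <- s | P e.1] = filter P (unzip1 s).
Proof. by rewrite /unzip1 filter_map. Qed.

Lemma completed_execution_times I b :
    uets_instance I -> bjobs b `<=` jobs I -> bmach b != finset.set0 ->
    completed_execution I b ->
  [/\ perm_eq (unzip1 (bcomp b)) (bjobs b), bstart b <= bend b,
      forall e, e \in bcomp b -> e.2 <= bend b &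
      forall e, e \in bcomp b -> bstart b + ptime I e.1 <= e.2].
Proof.
move=> [c0 cm cs p0 _] bI Mn0 [s [sb bc be _]].
have /bigmax_le_mem[bb bl] : \big[Num.max/bstart b]_(e <- bcomp b) e.2 <= bend b.
  by rewrite be.
split=> //; first by rewrite bc map_fst_fcfs ?loads_neq0.
move=> e; rewrite bc => /(fcfs_ge _ _); apply=> [j|l /nseqP[-> _]].
  by rewrite (perm_mem sb) => /(fsubsetP bI); exact: p0.
by rewrite lerDl c0.
Qed.

(** Treats completed and halted batches alike: both record a filtered list schedule, with [P]
    constantly true in the first case and membership in the set kept by the halt in the second. *)
Lemma offline_batch_times st I b :
    uets_instance I -> offline_batch st I b ->
  exists (s : seq nat) (P : pred nat),
    [/\ perm_eq s (bjobs b),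
        bcomp b = [seq e <- fcfs (ptime I)
          (nseq #|bmach b| (bstart b + setup I (bjobs b))) s | P e.1],
        bstart b <= bend b,
        forall e, e \in bcomp b -> e.2 <= bend b &
        forall e, e \in bcomp b -> bstart b + ptime I e.1 <= e.2].
Proof.
move=> uI [/and3P[_ Mn0 _] bI _ [cb|[_ [b0 [t [cb0 /andP[t0 _]]]]]]].
  have [_ be bl bg] := completed_execution_times uI bI Mn0 cb.
  case: cb => s [sb bc _ _]; exists s, predT; split=> //.
  by rewrite filter_predT.
move=> [X' [bE X'b eX tbe _]].
rewrite bE /= in bI Mn0 *; have [_ be bl bg] := completed_execution_times uI bI Mn0 cb0.
case: cb0 => s [sb bc _ _]; exists s, (mem X'); split=> //.
- by rewrite bc.
- by apply: le_trans t0 _; case/andP: tbe.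
- by move=> e; rewrite mem_filter => /andP[eX' eb]; case: (eX _ eb) => _; apply.
- by move=> e; rewrite mem_filter => /andP[_]; exact: bg.
Qed.

(* A halted batch is replaced by the complete execution of those jobs that it
   did complete; this keeps its place and never ends later. *)
Definition restrict I S b : batch R m :=
  let comp := fcfs (ptime I) (nseq #|bmach b|
                (bstart b + setup I (bdone b `&` S)))
                [seq j <- unzip1 (bcomp b) | j \in S] in
  Batch (bdone b `&` S) (bmach b) (bstart b) comp
    (\big[Num.max/bstart b]_(e <- comp) e.2) false.

Lemma bdone_sub b : bdone b `<=` bjobs b.
Proof. by apply/fsubsetP => j; rewrite !inE => /andP[]. Qed.

Section Restrict.
Variables (st : setting) (I : instance R) (S : {fset nat}) (b : batch R m).
Hypotheses (uI : uets_instance I) (ob : offline_batch st I b).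

Lemma restrict_completed : completed_execution (subinstance I S) (restrict I S b).
Proof.
exists [seq j <- unzip1 (bcomp b) | j \in S]; split=> //=.
have [s [P [sb bc _ _ _]]] := offline_batch_times uI ob.
have Mn0 : bmach b != finset.set0 by case: ob => /and3P[].
have ub : unzip1 (bcomp b) = filter P s.
  by rewrite bc map_fst_filter map_fst_fcfs ?loads_neq0.
have us : uniq s by rewrite (perm_uniq sb) fset_uniq.
apply: uniq_perm; [by rewrite ub !filter_uniq|exact: fset_uniq|].
move=> j; rewrite !inE mem_filter andbC; congr (_ && _).
rewrite ub mem_filter (perm_mem sb); apply/idP/idP; last by case/andP.
by move=> /andP[-> ->].
Qed.

(** Two changes, neither of which delays a job: by monotonicity the setup time does not grow, so the
    machines are ready no later, and the queue becomes a subsequence of the old one, which is the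
    situation of [fcfs_filter]. *)
Lemma restrict_earlier e : e \in bcomp (restrict I S b) ->
  exists2 e', e' \in bcomp b & e'.1 = e.1 /\ e.2 <= e'.2.
Proof.
have [s [P [sb bc _ _ _]]] := offline_batch_times uI ob.
have Mn0 : bmach b != finset.set0 by case: ob => /and3P[].
have bI : bjobs b `<=` jobs I by case: ob.
case: uI => c0 cm _ p0 _.
have ub : unzip1 (bcomp b) = filter P s.
  by rewrite bc map_fst_filter map_fst_fcfs ?loads_neq0.
have le_load : bstart b + setup I (bdone b `&` S) <=
    bstart b + setup I (bjobs b).
  rewrite lerD2l; apply: (cm _ _ _ bI).
  by apply: fsubset_trans (bdone_sub b); exact: fsubsetIl.
have ps j : j \in s -> 0 <= ptime I j.
  by rewrite (perm_mem sb) => /(fsubsetP bI); exact: p0.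
rewrite /= ub -filter_predI => eb.
have [e' e's [e'1 e2]] := fcfs_filter ps (sorted_nseq _ _) (sorted_nseq _ _)
  (earlier_nseq #|bmach b| le_load) eb.
exists e' => //; rewrite bc mem_filter e's andbT e'1.
have := map_f fst eb; rewrite -/(unzip1 _) map_fst_fcfs ?loads_neq0 //.
by rewrite mem_filter => /andP[/andP[]].
Qed.

Lemma bend_restrict : bend (restrict I S b) <= bend b.
Proof.
have [s [P [_ _ bb be _]]] := offline_batch_times uI ob.
apply/bigmax_le_mem; split=> // e /restrict_earlier[e' /be e'b [_ ee]].
exact: le_trans ee e'b.
Qed.

Lemma bdone_restrict : bdone (restrict I S b) = bdone b `&` S.
Proof.
have Mn0 : bmach b != finset.set0 by case: ob => /and3P[].
apply/fsetP => j; rewrite !inE /= map_fst_fcfs ?loads_neq0 // mem_filter.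
by case: (j \in S); case: (j \in bjobs b); case: (j \in unzip1 (bcomp b)).
Qed.

Lemma offline_restrict : bdone b `&` S != fset0 ->
  offline_batch st (subinstance I S) (restrict I S b).
Proof.
case: (ob) => /and3P[bn0 Mn0 Mst] bI br _ dn0; split=> /=.
- by rewrite /batch_shape dn0 Mn0.
- exact: fsubsetIr.
(* Release times are now 0, so the start has to be nonnegative; the old release time of the same job
   ensures it. *)
- move=> j; rewrite !inE => /andP[/andP[jb _] _]; apply: le_trans (br j jb).
  by case: uI => _ _ _ _; apply; exact: (fsubsetP bI).
- by left; exact: restrict_completed.
Qed.

End Restrict.

Lemma fdisjointS (X X' Y Y' : {fset nat}) : X' `<=` X -> Y' `<=` Y ->
  [disjoint X & Y] -> [disjoint X' & Y'].
Proof. by move=> XX YY /(fdisjointWl XX)/(fdisjointWr YY). Qed.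

Lemma compatible_restrict st I S b1 b2 : uets_instance I ->
    offline_batch st I b1 -> offline_batch st I b2 ->
  compatible b1 b2 -> compatible (restrict I S b1) (restrict I S b2).
Proof.
move=> uI ob1 ob2.
have sub b : bdone b `&` S `<=` bjobs b.
  by apply: fsubset_trans (bdone_sub b); exact: fsubsetIl.
have prec b b' : offline_batch st I b -> precedes b b' ->
    precedes (restrict I S b) (restrict I S b').
  move=> ob [le dis]; split; first exact: le_trans (bend_restrict S uI ob) le.
  by rewrite (bdone_restrict S ob) (fdisjointS _ _ dis) ?fsubsetIl ?sub.
case=> [[disM disJ]|p12|p21]; last 2 first.
- by apply: Or32; exact: prec.
- by apply: Or33; exact: prec.
by apply: Or31; split=> //=; apply: fdisjointS disJ.
Qed.

Lemma makespan_restrict st I S (sigma : seq (batch R m)) (Q : pred (batch R m)) :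
    uets_instance I -> (forall b, List.In b sigma -> offline_batch st I b) ->
  makespan [seq restrict I S b | b <- sigma & Q b] <= makespan sigma.
Proof.
move=> uI ob; rewrite /makespan big_map.
have [ms0 msg] := (bigmax_le_mem 0 _ sigma
  (fun b => \big[Num.max/0]_(e <- bcomp b) e.2)).1 (lexx _).
apply/bigmax_le_mem; split=> // b; rewrite mem_filter => /andP[_ bs].
have [_ mbg] := (bigmax_le_mem 0 _ (bcomp b) snd).1 (msg _ bs).
apply/bigmax_le_mem; split=> // e.
case/(restrict_earlier uI (ob _ ((InP _ _).2 bs))) => e' /mbg e'm [_ ee].
exact: le_trans ee e'm.
Qed.

Lemma ForallOrdPairsP (T : eqType) (P : T -> T -> Prop) (f : T -> T)
    (Q : pred T) (s : seq T) :
    (forall x y, x \in s -> y \in s -> P x y -> P (f x) (f y)) ->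
  List.ForallOrdPairs P s ->
  List.ForallOrdPairs P [seq f x | x <- s & Q x].
Proof.
elim: s => [|x s IHs] Pf Ps /=; first exact: List.FOP_nil.
inversion_clear Ps as [|? ? Px Ps'].
have {}IHs : List.ForallOrdPairs P [seq f y | y <- s & Q y].
  by apply: IHs Ps' => y z ys zs; apply: Pf; rewrite inE (ys, zs) orbT.
case: ifP => // _; apply: List.FOP_cons IHs.
apply/List.Forall_forall => _ /InP/mapP[y + ->].
rewrite mem_filter => /andP[_ ys]; apply: Pf; rewrite ?mem_head // ?inE ?ys ?orbT //.
by move/List.Forall_forall: Px; apply; apply/InP.
Qed.

Lemma offline_schedule_restrict st I S (sigma : seq (batch R m)) :
    uets_instance I -> S `<=` jobs I -> offline_schedule st I sigma ->
  offline_schedule st (subinstance I S)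
    [seq restrict I S b | b <- sigma & bdone b `&` S != fset0].
Proof.
move=> uI SI [ob compat cover]; split.
- move=> _ /InP/mapP[b + ->]; rewrite mem_filter => /andP[bS /InP/ob obb].
  exact: offline_restrict.
- apply: ForallOrdPairsP compat => b b' /InP/ob ob1 /InP/ob ob2.
  exact: (compatible_restrict S uI ob1 ob2).
- move=> j jS; have [b [bs jb]] := cover _ (fsubsetP SI _ jS).
  have jbS : j \in bdone b `&` S by rewrite in_fsetI jb.
  exists (restrict I S b); rewrite (bdone_restrict S (ob _ bs)); split=> //.
  apply/InP/map_f; rewrite mem_filter (InP _ _).1 // andbT.
  by apply/fset0Pn; exists j.
Qed.

Lemma makespan_ge0 (sigma : seq (batch R m)) : 0 <= makespan sigma.
Proof.
by case: ((bigmax_le_mem 0 _ sigma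
  (fun b => \big[Num.max/0]_(e <- bcomp b) e.2)).1 (lexx _)).
Qed.

(** [opt] is an infimum, and lower bounds pass to it only over a nonempty set. One batch of all
    jobs, on one machine and started at the last release, fits every setting; without jobs the empty
    schedule is taken, since a batch is nonempty. *)
Lemma exists_offline_schedule st I : (0 < m)%N -> uets_instance I ->
  exists sigma : seq (batch R m), offline_schedule st I sigma.
Proof.
move=> m0 uI; have [J0|Jn0] := eqVneq (jobs I) fset0.
  exists [::]; split=> [b []||j]; first exact: List.FOP_nil.
  by rewrite J0 inE.
pose M : {set 'I_m} := [set Ordinal m0]%SET.
have Mn0 : M != finset.set0 by rewrite -card_gt0 cards1.
pose r := \big[Num.max/0]_(j <- jobs I) rtime I j.
pose comp := fcfs (ptime I) (nseq #|M| (r + setup I (jobs I))) (jobs I).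
pose b := Batch (jobs I) M r comp (\big[Num.max/r]_(e <- comp) e.2) false.
have cb : completed_execution I b by exists (jobs I).
exists [:: b]; split.
- move=> _ [<-|[]]; split=> //=; last by left.
    by rewrite /batch_shape Jn0 Mn0 cards1 eqxx orbT.
  by move=> j jI; have [_] := (bigmax_le_mem 0 r (jobs I) (rtime I)).1 (lexx _); apply.
- by apply: List.FOP_cons; [exact: List.Forall_nil|exact: List.FOP_nil].
- move=> j jI; exists b; split; first by left.
  by rewrite !inE /= map_fst_fcfs ?loads_neq0 // jI.
Qed.

Lemma opt_subinstance st I S : (0 < m)%N ->
  uets_instance I -> S `<=` jobs I -> opt m st (subinstance I S) <= opt m st I.
Proof.
move=> m0 uI SI; apply: lb_le_inf.
  by have [sigma os] := exists_offline_schedule st m0 uI; exists (makespan sigma), sigma.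
move=> _ [sigma os <-]; have [ob _ _] := os.
apply: le_trans (makespan_restrict S (fun b => bdone b `&` S != fset0) uI ob).
apply: ge_inf; first by exists 0 => _ [tau _ <-]; exact: makespan_ge0.
by eexists; [exact: (offline_schedule_restrict uI SI os)|].
Qed.

(** The release time bounds the starts of subschedules; the execution time serves the unit job that
    forces [rho] to be nonnegative. *)
Lemma rtime_ptime_le_opt st I j : (0 < m)%N -> uets_instance I ->
  j \in jobs I -> rtime I j + ptime I j <= opt m st I.
Proof.
move=> m0 uI jI; apply: lb_le_inf.
  by have [sigma os] := exists_offline_schedule st m0 uI; exists (makespan sigma), sigma.
move=> _ [sigma [ob _ cover] <-]; have [b [bs]] := cover j jI.
rewrite !inE => /andP[jb /mapP[e eb je]].
have [_ [_ [_ _ _ _ /(_ e eb) be]]] := offline_batch_times uI (ob _ bs).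
have br : rtime I j <= bstart b by case: (ob _ bs) => _ _ /(_ j jb).
rewrite -je in be; apply: le_trans (_ : _ <= e.2) _.
  by apply: le_trans be; rewrite lerD2r.
apply: le_trans (le_bigmax_seq 0 b xpredT _ ((InP _ _).1 bs) isT).
exact: (le_bigmax_seq 0 e xpredT snd).
Qed.

End Optimum.

(** * Reachable configurations *)

Section Shift.
Context {R : realType} {m : nat}.
Implicit Types (I : instance R) (b : batch R m) (d t : R).

Definition shift_time d (e : nat * R) : nat * R := (e.1, d + e.2).

Definition shift d b : batch R m :=
  Batch (bjobs b) (bmach b) (d + bstart b) (map (shift_time d) (bcomp b))
    (d + bend b) (bhalted b).

Lemma shift_timeK d : cancel (shift_time d) (shift_time (- d)).
Proof. by case=> j x; rewrite /shift_time /= addKr. Qed.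

(** Invertibility lets an arbitrary outcome on the real clock be read as an outcome on the clock of
    [A], which starts at 0 in each subschedule. *)
Lemma shiftK d : cancel (shift d) (shift (- d)).
Proof. by case=> X M s c e h; rewrite /shift /= !addKr mapK //; exact: shift_timeK. Qed.

Lemma shiftVK d : cancel (shift (- d)) (shift d).
Proof. by move=> b; have := shiftK (- d) b; rewrite opprK. Qed.

Lemma shift_completed I d b :
  completed_execution I b -> completed_execution I (shift d b).
Proof.
move=> [s [sb bc be bh]]; exists s; split=> //=.
  by rewrite bc -(fcfs_shift _ d) map_nseq addrA.
rewrite be big_map (big_morph (+%R d) (addr_maxr d) (erefl _)) //.
Qed.

Lemma shift_halted I d t b b' :
  halted_execution I t b b' -> halted_execution I (d + t) (shift d b) (shift d b').
Proof.
move=> [X' [bE XX' eX tb tX]]; exists X'; split=> //=.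
- rewrite bE /shift /= filter_map; congr Batch.
- move=> _ /mapP[e eb ->] /=; rewrite !lerD2l; exact: eX.
- by rewrite -addrA -addr_minr !lerD2l.
- by rewrite opprD addrACA subrr add0r.
Qed.

End Shift.

Section Invariant.
Context {R : realType} {m : nat}.
Implicit Types (I : instance R) (b : batch R m) (cfg : config R m).

Lemma uniq_fst_inj (T : eqType) (s : seq (nat * T)) (e e' : nat * T) :
  uniq (unzip1 s) -> e \in s -> e' \in s -> e.1 = e'.1 -> e = e'.
Proof.
elim: s => //= x s IHs /andP[xs us]; rewrite !inE.
case/predU1P=> [->|es]; case/predU1P=> [->|es'] // ee.
- by case/negP: xs; rewrite ee map_f.
- by case/negP: xs; rewrite -ee map_f.
- exact: IHs.
Qed.

(* [wf_end]: the machines of a batch can stay busy after its last completion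
   only if the batch was halted and left a job uncompleted. *)
Record wf_batch (x : R) (C : {fset nat}) b : Prop := WfBatch {
  wf_mach : bmach b != finset.set0;
  wf_uniq : uniq (unzip1 (bcomp b));
  wf_comp : {subset unzip1 (bcomp b) <= bjobs b};
  wf_done : forall j, j \in bjobs b -> j \in C ->
    exists2 e, e \in bcomp b & e.1 = j /\ e.2 <= x;
  wf_end : (forall j, j \in bjobs b -> j \in unzip1 (bcomp b)) ->
    exists2 e, e \in bcomp b & bend b <= e.2 }.

(** Through [wf_new] every job still unreleased bounds the current time, which is how starts of
    subschedules get compared with the optimum. [wf_disj] assigns each running job to one batch. *)
Record wf_config I cfg : Prop := WfConfig {
  wf_rel : released cfg `<=` jobs I;
  wf_fin : completed cfg `<=` released cfg;
  wf_new : forall j, j \in jobs I -> j \notin released cfg -> now cfg <= rtime I j;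
  wf_disj : pairwise (fun X Y : {fset nat} => [disjoint X & Y])
    (map (@bjobs R m) (running cfg));
  wf_run : forall b, b \in running cfg ->
    bjobs b `<=` released cfg /\ wf_batch (now cfg) (completed cfg) b }.

Lemma wf_start st I cfg h b : uets_instance I -> wf_config I cfg ->
    can_start st cfg (bjobs b) (bmach b) -> completed_execution I b ->
  wf_config I (Config (now cfg) h (released cfg) (completed cfg) (b :: running cfg)).
Proof.
move=> uI [wr wc wn wd wb] /and5P[/and3P[bn0 Mn0 _] brel bC bR _] cb.
have [pb bb be bg] := completed_execution_times uI (fsubset_trans brel wr) Mn0 cb.
split=> //=.
  by rewrite all_map; apply/andP; split.
move=> b'; rewrite inE => /predU1P[->|/wb] //; split=> //; split=> //.
- by rewrite (perm_uniq pb) fset_uniq.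
- by move=> j; rewrite (perm_mem pb).
- by move=> j jb; rewrite (negbTE (fdisjointP bC _ jb)).
move=> _; case: cb => s [_ _ bendE _].
(* The maximum defining [bend b] is attained by a job: there is one, and no job is completed before
   the default value [bstart b]. *)
have [||e eb eE] := @bigmax_attained _ _ (bstart b) (bcomp b) snd.
- by apply: contraNneq bn0 => b0; rewrite -cardfs_eq0 -(perm_size pb) b0.
- move=> e eb; apply: le_trans (bg e eb); rewrite lerDl.
  case: uI => _ _ _ p0 _; apply/p0/(fsubsetP (fsubset_trans brel wr)).
  by rewrite -(perm_mem pb) map_f.
by exists e; rewrite // bendE eE.
Qed.

Lemma wf_halt I cfg h r1 b r2 b' : wf_config I cfg ->
    running cfg = r1 ++ b :: r2 -> halted_execution I (now cfg) b b' ->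
  wf_config I (Config (now cfg) h (released cfg) (completed cfg) (r1 ++ b' :: r2)).
Proof.
move=> [wr wc wn wd wb] rE [X' [b'E XX' eX /andP[_ tb] tX]].
have jE : bjobs b' = bjobs b by rewrite b'E.
split=> //=; first by rewrite map_cat /= jE -map_cons -map_cat -rE.
move=> b1; rewrite mem_cat inE orbCA => /predU1P[{b1}->|b1r]; last first.
  by apply: wb; rewrite rE mem_cat inE orbCA b1r orbT.
have [|brel [wm wu ws wdn we]] := wb b.
  by rewrite rE mem_cat inE eqxx orbT.
rewrite jE; split=> //.
have compE : bcomp b' = [seq e <- bcomp b | e.1 \in X'] by rewrite b'E.
split; rewrite ?jE ?compE.
- by rewrite b'E.
- by rewrite map_fst_filter filter_uniq.
- by move=> j; rewrite map_fst_filter mem_filter => /andP[_]; exact: ws.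
- move=> j jb /(wdn j jb)[e eb [ej et]]; exists e => //.
  by rewrite mem_filter eb andbT; case: (eX e eb) => + _; apply.
(* If the halt loses no job, the batch before the halt completes all its jobs too, and halting never
   postpones [bend]. *)
- move=> all_done; have [|e eb be] := we.
    by move=> j /all_done; rewrite map_fst_filter mem_filter => /andP[].
  have : e.1 \in [seq j <- unzip1 (bcomp b) | j \in X'].
    by rewrite -map_fst_filter; apply/all_done/ws/map_f.
  rewrite mem_filter => /andP[eX' _]; exists e; first by rewrite mem_filter eX'.
  by apply: le_trans be; move: tb; rewrite le_min => /andP[].
Qed.

Lemma pairwise_running_disj I cfg b b' j : wf_config I cfg ->
  b \in running cfg -> b' \in running cfg -> j \in bjobs b -> j \in bjobs b' -> b = b'.
Proof.
move=> [_ _ _ + _]; elim: (running cfg) => //= x s IHs /andP[xs ps].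
rewrite !inE; case/predU1P=> [->|bs]; case/predU1P=> [->|bs'] // jb jb'.
- by move/allP: xs => /(_ _ (map_f _ bs'))/fdisjointP/(_ _ jb)/negP.
- by move/allP: xs => /(_ _ (map_f _ bs))/fdisjointP/(_ _ jb')/negP.
- exact: IHs.
Qed.

Lemma mem_upcoming I cfg w x :
  x \in upcoming I cfg w <->
  [\/ exists2 b, b \in running cfg &
       exists2 e, e \in bcomp b & e.1 \notin completed cfg /\ e.2 = x,
     exists2 b, b \in running cfg & bend b = x,
     exists2 j, j \in jobs I `\` released cfg & rtime I j = x | w = Some x].
Proof.
rewrite /upcoming !mem_cat; split.
- case/or4P.
  + case/mapP=> e; rewrite mem_filter => /andP[ec /flattenP[_ /mapP[b br ->] eb]] ->.
    by apply: Or41; exists b => //; exists e.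
  + by case/mapP=> b br ->; apply: Or42; exists b.
  + by case/mapP=> j jr ->; apply: Or43; exists j.
  + by case: w => //= y; rewrite inE => /eqP ->; apply: Or44.
- case=> [[b br [e eb [ec <-]]]|[b br <-]|[j jr <-]|->].
  + apply/or4P/Or41/map_f; rewrite mem_filter ec; apply/flattenP.
    by exists (bcomp b) => //; apply: map_f.
  + by apply/or4P/Or42/map_f.
  + by apply/or4P/Or43/map_f.
  + by apply/or4P/Or44; rewrite /= mem_head.
Qed.

Lemma mem_newly_completed I cfg (x : R) j :
  j \in [fset j in jobs I | (j \notin completed cfg) &&
          has (fun b => (j, x) \in bcomp b) (running cfg)] <->
  [/\ j \in jobs I, j \notin completed cfg &
     exists2 b, b \in running cfg & (j, x) \in bcomp b].
Proof.
rewrite !inE; split; first by case/andP=> jI /andP[jc /hasP].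
by case=> -> -> ?; apply/hasP.
Qed.

(** The inequality for running batches is strict because no batch ends before the minimal [x] and
    those ending at [x] are removed. *)
Lemma wf_advance I cfg w x : wf_config I cfg -> now cfg <= x ->
    all (fun u => x <= u) (upcoming I cfg w) ->
  wf_config I (advance I cfg w x) /\
  forall b, b \in running (advance I cfg w x) -> x < bend b.
Proof.
move=> wf nx /allP up; have [wr wc wn wd wb] := wf; split; last first.
  move=> b /=; rewrite mem_filter => /andP[bx br].
  by rewrite lt_neqAle eq_sym bx up //; apply/mem_upcoming/Or42; exists b.
split=> /=.
- by apply/fsubUsetP; split=> //; apply/fsubsetP => j; rewrite !inE => /andP[].
- apply/fsubUsetP; split; first by rewrite (fsubset_trans wc) ?fsubsetUl.
  apply/fsubsetP => j /mem_newly_completed[jI _ [b br jb]]; apply/fsetUP; left.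
  have [brel wbb] := wb _ br; apply/(fsubsetP brel)/(wf_comp wbb).
  exact: (map_f fst jb).
- move=> j jI; rewrite !inE jI negb_or /= => /andP[jr _].
  by apply: up; apply/mem_upcoming/Or43; exists j; rewrite // !inE jr.
- by move: wd; rewrite !pairwise_map; exact: pairwise_filter.
- move=> b; rewrite mem_filter => /andP[_ br]; have [brel wbb] := wb _ br.
  split; first by rewrite (fsubset_trans brel) ?fsubsetUl.
  have [wm wu ws wdn we] := wbb; split=> // j jb /fsetUP[jc|].
    by have [e eb [ej ex]] := wdn j jb jc; exists e => //; split=> //; exact: le_trans nx.
  case/mem_newly_completed=> jI jc [b' b'r jb'].
  have jb'' : j \in bjobs b' by apply: (wf_comp (wb _ b'r).2); exact: (map_f fst jb').
  (* The batch that reports the completion shares the job with [b], hence is [b] itself. *)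
  rewrite (pairwise_running_disj wf br b'r jb jb''); exists (j, x) => //.
Qed.

(* Hence all machines are free as soon as all jobs of a subschedule are completed. *)
Lemma running_unfinished I cfg b : wf_config I cfg -> b \in running cfg ->
  now cfg < bend b -> ~~ (bjobs b `<=` completed cfg).
Proof.
move=> [_ _ _ _ wb] br nb; apply/negP => /fsubsetP bC.
have [_ [_ wu ws wdn we]] := wb _ br.
have [j jb|e eb be] := we.
  by have [e eb [<- _]] := wdn j jb (bC _ jb); exact: map_f.
(* Job names being unique in [bcomp b], [wf_end] and [wf_done] speak of the same entry, which lies
   both at or after [bend b] and at or before now. *)
have ejb : e.1 \in bjobs b by apply/ws/map_f.
have [e' e'b [e'e e'n]] := wdn _ ejb (bC _ ejb).
have /le_trans := be; rewrite -(uniq_fst_inj wu e'b eb e'e) => /(_ _ e'n).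
by rewrite leNgt nb.
Qed.

End Invariant.

(** * Simulation of a subschedule *)

Section Simulation.
Context {R : realType} {m : nat}.
Implicit Types (b : batch R m) (x : R) (w : option R).
Variables (I : instance R) (A : algorithm R m).

Implicit Types (cfg : config R m) (S C : {fset nat}) (J : instance R).

Definition newly_completed J cfg x : {fset nat} :=
  [fset j in jobs J | (j \notin completed cfg) &&
     has (fun b => (j, x) \in bcomp b) (running cfg)].

Definition newly_free cfg x : {set 'I_m} :=
  (\bigcup_(b <- running cfg | bend b == x) bmach b)%SET.

Lemma mem_newly_free cfg x i :
  i \in newly_free cfg x <->
  exists2 b, b \in running cfg & bend b = x /\ i \in bmach b.
Proof.
rewrite /newly_free; elim: (running cfg) => [|b s IHs].
  by rewrite big_nil finset.inE; split=> // -[].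
rewrite big_cons; case: eqP => [bx|bx].
  rewrite finset.inE; split=> [/orP[ib|/IHs[b' b's b'P]]|[b']].
  - by exists b; rewrite ?mem_head.
  - by exists b'; rewrite // inE b's orbT.
  - rewrite inE => /predU1P[-> [_ ->] //|b's b'P].
    by apply/orP; right; apply/IHs; exists b'.
split=> [/IHs[b' b's b'P]|[b']]; first by exists b'; rewrite // inE b's orbT.
by rewrite inE => /predU1P[-> []|b's b'P] //; apply/IHs; exists b'.
Qed.

(** Covers two situations at once, since [begin_subschedule] yields [None] on the empty set: idle
    machines with nothing to do, and a subschedule that has just begun without any command so
    far. *)
Record between cfg : Prop := Between {
  between_wf : wf_config I cfg;
  between_idle : running cfg = [::];
  between_hist : foldr ignore_update None (hist cfg) =
    begin_subschedule (now cfg) (released cfg `\` completed cfg) }.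

(* The configuration [cfg] of IGNORE on [I] during a subschedule for [S] that
   began at time [t0] mirrors the configuration [cfg'] of [A] on [S].  A release
   that is hidden from [A] advances only [now cfg]; in that case [A] keeps
   waiting. *)
Record simulates t0 S C cfg cfg' : Prop := Simulates {
  sim_wf : wf_config I cfg;
  sim_sub : S `<=` released cfg;
  sim_old : C `<=` completed cfg;
  sim_rel : released cfg' = S;
  sim_comp : completed cfg' = completed cfg `&` S;
  sim_run : running cfg = map (shift t0) (running cfg');
  sim_jobs : forall b, b \in running cfg' -> bjobs b `<=` S;
  sim_hist : foldr ignore_update None (hist cfg) =
    Some (Subschedule t0 S (S `\` completed cfg)
            (released cfg `\` (S `|` completed cfg)) (hist cfg'));
  sim_todo : S `\` completed cfg != fset0;
  sim_now : now cfg = t0 + now cfg' \/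
    exists w, [/\ A (known_setup (subinstance I S) cfg') (hist cfg') = Wait w,
      t0 + now cfg' <= now cfg &
      forall u, u \in upcoming (subinstance I S) cfg' w -> now cfg <= t0 + u] }.

(** [A] depends only on its two arguments. The histories agree by [sim_hist], and both setup-time
    functions cut their argument down to [S], as [S] is contained in the released jobs. *)
Lemma ignore_command t0 S C cfg cfg' : simulates t0 S C cfg cfg' ->
  ignore A (known_setup I cfg) (hist cfg) =
  match A (known_setup (subinstance I S) cfg') (hist cfg') with
  | Wait w => Wait (omap (+%R t0) w)
  | cmd => cmd
  end.
Proof.
move=> sim; rewrite /ignore /= (sim_hist sim) /=.
rewrite (_ : (fun X => _) = known_setup (subinstance I S) cfg') //.
apply/funext => X; rewrite /known_setup (sim_rel sim) /=; congr (setup I _).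
by rewrite -fsetIA (fsetIidPl (sim_sub sim)).
Qed.

Section Observations.
Variables (t0 : R) (S C : {fset nat}) (cfg cfg' : config R m).
Hypothesis sim : simulates t0 S C cfg cfg'.
Let IS := subinstance I S.

Lemma sim_batch b : b \in running cfg' ->
  bmach b != finset.set0 /\ {subset unzip1 (bcomp b) <= bjobs b}.
Proof.
move=> br; have [|_ [wm _ ws _ _]] := wf_run (sim_wf sim) (b := shift t0 b).
  by rewrite (sim_run sim) map_f.
split=> // j jb; apply: ws; rewrite /= /unzip1 -map_comp //.
Qed.

Lemma sim_inS b e : b \in running cfg' -> e \in bcomp b -> e.1 \in S.
Proof.
move=> br eb; apply/(fsubsetP (sim_jobs sim br)).
by apply: (sim_batch br).2; exact: map_f.
Qed.

Lemma sim_S_jobs : S `<=` jobs I.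
Proof. exact: fsubset_trans (sim_sub sim) (wf_rel (sim_wf sim)). Qed.

Lemma sim_completed j : j \in S -> (j \in completed cfg') = (j \in completed cfg).
Proof. by move=> jS; rewrite (sim_comp sim) in_fsetI jS andbT. Qed.

Lemma sim_newly_completed x :
  newly_completed I cfg (t0 + x) = newly_completed IS cfg' x.
Proof.
apply/fsetP => j; apply/idP/idP => /mem_newly_completed[jI jC [b br jb]];
  apply/mem_newly_completed.
- move: br jb; rewrite (sim_run sim) => /mapP[b' br' ->] /mapP[e eb [je ex]].
  have {}ex := addrI _ ex.
  have jS : j \in S by rewrite je (sim_inS br').
  by split; rewrite ?sim_completed //; exists b' => //; rewrite je ex -surjective_pairing.
- split; [exact: (fsubsetP sim_S_jobs)|by rewrite -sim_completed|].
  exists (shift t0 b); first by rewrite (sim_run sim) map_f.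
  by apply/mapP; exists (j, x).
Qed.

Lemma sim_newly_free x : newly_free cfg (t0 + x) = newly_free cfg' x.
Proof.
rewrite /newly_free (sim_run sim) big_map; apply: eq_bigl => b /=.
by rewrite (inj_eq (addrI t0)).
Qed.

Lemma sim_unreleased : jobs IS `\` released cfg' = fset0.
Proof. by rewrite (sim_rel sim) /= fsetDv. Qed.

Lemma sim_mem_upcoming w x :
  x \in upcoming I cfg (omap (+%R t0) w) <->
  (exists2 u, u \in upcoming IS cfg' w & x = t0 + u) \/
  (exists2 j, j \in jobs I `\` released cfg & rtime I j = x).
Proof.
split; last first.
  case=> [[u u_up ->]|?]; last exact/mem_upcoming/Or43.
  case/mem_upcoming: u_up => [[b br [e eb [ec <-]]]|[b br <-]|[j]|->].
  + apply/mem_upcoming/Or41; exists (shift t0 b); first by rewrite (sim_run sim) map_f.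
    exists (shift_time t0 e); first exact: map_f.
    by rewrite /= -sim_completed // (sim_inS br eb).
  + by apply/mem_upcoming/Or42; exists (shift t0 b); rewrite // (sim_run sim) map_f.
  + by rewrite sim_unreleased inE.
  + exact/mem_upcoming/Or44.
case/mem_upcoming=> [[b]|[b]|?|].
- rewrite (sim_run sim) => /mapP[b' br ->] [_ /mapP[e eb ->]] /= [ec <-].
  left; exists e.2 => //; apply/mem_upcoming/Or41; exists b' => //; exists e => //.
  by rewrite sim_completed // (sim_inS br).
- rewrite (sim_run sim) => /mapP[b' br ->] <-.
  by left; exists (bend b') => //; apply/mem_upcoming/Or42; exists b'.
- by right.
- by case: w => //= u [<-]; left; exists u => //; apply/mem_upcoming/Or44.
Qed.

(** The test [hidden] of [ignore_update] fails exactly at the events of the run of [A]: all of [S]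
    is released there, and a batch that ends frees at least one machine. *)
Lemma sim_visible w x : x \in upcoming IS cfg' w <->
  ~~ [&& nilp [seq (j, ptime I j) | j <- newly_completed IS cfg' x],
         newly_free cfg' x == finset.set0 & ~~ (w == Some x)].
Proof.
rewrite !negb_and negbK; split=> [/mem_upcoming[[b br [e eb [ec <-]]]|[b br bx]|[j]|->]|].
- apply/orP; left; rewrite /nilp size_map size_eq0; apply/eqP.
  move=> D0; have : e.1 \in newly_completed IS cfg' e.2.
    apply/mem_newly_completed; split=> //; first exact: (sim_inS br).
    by exists b; rewrite -?surjective_pairing.
  by rewrite /newly_completed -[_ \in _]/(e.1 \in enum_fset _) D0.
- apply/or3P/Or32/finset.set0Pn; have [/finset.set0Pn[i ib] _] := sim_batch br.
  by exists i; apply/mem_newly_free; exists b.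
- by rewrite sim_unreleased inE.
- by rewrite eqxx !orbT.
case/or3P.
- rewrite /nilp size_map -lt0n -has_predT => /hasP[j] /mem_newly_completed.
  case=> jS jC [b br jb] _; apply/mem_upcoming/Or41.
  by exists b => //; exists (j, x).
- case/finset.set0Pn=> i /mem_newly_free[b br [bx _]].
  by apply/mem_upcoming/Or42; exists b.
- by move/eqP->; apply/mem_upcoming/Or44.
Qed.

End Observations.

Section Advance.
Variables (t0 : R) (S C : {fset nat}) (cfg cfg' : config R m).
Hypothesis sim : simulates t0 S C cfg cfg'.
Let IS := subinstance I S.
Variables (w : option R) (x : R).
Hypothesis A_waits : A (known_setup IS cfg') (hist cfg') = Wait w.
Hypothesis now_x : now cfg <= t0 + x.
Let w' := omap (+%R t0) w.
Hypothesis x_min : all (fun u => t0 + x <= u) (upcoming I cfg w').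
Let cfg2 := advance I cfg w' (t0 + x).
Let cfg2' := advance IS cfg' w x.

Let wf2 : wf_config I cfg2.
Proof. by have [] := wf_advance (sim_wf sim) now_x x_min. Qed.

Let released2 : released cfg2' = S.
Proof.
rewrite -[RHS](sim_rel sim) /=; apply/fsetP => j; rewrite !inE (sim_rel sim).
by case: (j \in S).
Qed.

(** Deleting the releases from an observation agrees with the run on [S], where no release is left
    to be observed. *)
Let event2 : Observed [seq (j, ptime I j) | j <- newly_completed I cfg (t0 + x)]
    (newly_free cfg (t0 + x)) fset0 (w' == Some (t0 + x)) =
  Observed [seq (j, ptime I j) | j <- newly_completed IS cfg' x]
    (newly_free cfg' x)
    [fset j in jobs IS | (j \notin released cfg') && (rtime IS j == x)]
    (w == Some x).
Proof.
rewrite (sim_newly_completed sim) (sim_newly_free sim); congr Observed.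
- by apply/fsetP => j; rewrite !inE (sim_rel sim) /=; case: (j \in S).
- rewrite /w'; case: (w) => //= u; rewrite !(inj_eq Some_inj).
  by rewrite (inj_eq (addrI t0)).
Qed.

Let todo2 : [fset j in S `\` completed cfg |
    j \notin unzip1 [seq (j, ptime I j) | j <- newly_completed I cfg (t0 + x)]]
  = S `\` completed cfg2.
Proof.
apply/fsetP => j; rewrite /unzip1 -map_comp map_id /cfg2 /= -/(newly_completed I cfg _).
rewrite in_fsetD in_fsetU negb_or !inE /=.
by rewrite andbAC.
Qed.

Lemma newly_completed_sub : newly_completed I cfg (t0 + x) `<=` S.
Proof.
rewrite (sim_newly_completed sim).
by apply/fsubsetP => j /mem_newly_completed[].
Qed.

Let backlog2 : released cfg `\` (S `|` completed cfg) `|`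
    [fset j in jobs I | (j \notin released cfg) && (rtime I j == t0 + x)]
  = released cfg2 `\` (S `|` completed cfg2).
Proof.
change (released cfg2) with (released cfg `|`
    [fset j in jobs I | (j \notin released cfg) && (rtime I j == t0 + x)]).
change (completed cfg2) with (completed cfg `|` newly_completed I cfg (t0 + x)).
set N := [fset j in jobs I | _]; set D := newly_completed _ _ _.
apply/fsetP => j; rewrite !(in_fsetU, in_fsetD).
have DS : j \in D -> j \in S by exact: (fsubsetP newly_completed_sub).
have SR : j \in S -> j \in released cfg by exact: (fsubsetP (sim_sub sim)).
have CR : j \in completed cfg -> j \in released cfg.
  exact: (fsubsetP (wf_fin (sim_wf sim))).
have NR : j \in N -> j \notin released cfg by rewrite !inE => /and3P[].
case: (j \in D) DS => [/(_ isT) jS|_]; first by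
  rewrite jS !orbT /=; apply/negbTE/negP => /NR; rewrite SR.
case: (j \in N) NR => [/(_ isT) jR|_]; last by rewrite !orbF.
by rewrite !orbF !orbT andbT; apply/esym/norP; split;
  [exact: contraNN SR jR|exact: contraNN CR jR].
Qed.

Lemma hist_advance : foldr ignore_update None (hist cfg2) =
  if S `\` completed cfg2 == fset0
  then begin_subschedule (now cfg2) (released cfg2 `\` completed cfg2)
  else Some (Subschedule t0 S (S `\` completed cfg2)
    (released cfg2 `\` (S `|` completed cfg2))
    (if x \in upcoming IS cfg' w then hist cfg2' else hist cfg')).
Proof.
change (foldr ignore_update None (hist cfg2)) with
  (ignore_update (t0 + x, Observed
      [seq (j, ptime I j) | j <- newly_completed I cfg (t0 + x)]
      (newly_free cfg (t0 + x))
      [fset j in jobs I | (j \notin released cfg) && (rtime I j == t0 + x)]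
      (w' == Some (t0 + x))) (foldr ignore_update None (hist cfg))).
rewrite (sim_hist sim); cbv beta iota zeta delta [ignore_update].
rewrite todo2 backlog2; case: eqP => [S0|_].
  (* With [S] exhausted, leaving out [S] besides the completed jobs removes nothing more. *)
  congr (begin_subschedule _ (_ `\` _)); apply/fsetUidPr.
  by rewrite -fsetD_eq0 S0.
congr (Some (Subschedule _ _ _ _ _)).
rewrite event2 [t0 + x - t0]addrC addKr (sim_newly_completed sim) (sim_newly_free sim).
have -> : (w' == Some (t0 + x)) = (w == Some x).
  by move: event2 => [_ _ _ ->].
have vis := sim_visible sim w x.
by case: ifP => hid; case: ifP => // up; [move/vis: up|case/negP: up; apply/vis]; rewrite hid.
Qed.

Lemma sim_advance : x \in upcoming IS cfg' w -> S `\` completed cfg2 != fset0 ->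
  simulates t0 S C cfg2 cfg2'.
Proof.
move=> x_up todo; split=> //.
- by apply: fsubset_trans (sim_sub sim) _; exact: fsubsetUl.
- by apply: fsubset_trans (sim_old sim) _; exact: fsubsetUl.
- change (completed cfg' `|` newly_completed IS cfg' x =
    (completed cfg `|` newly_completed I cfg (t0 + x)) `&` S).
  by rewrite fsetIUl -(sim_comp sim) (fsetIidPl newly_completed_sub)
    (sim_newly_completed sim).
- rewrite /= (sim_run sim) filter_map; congr map; apply: eq_filter => b /=.
  by rewrite (inj_eq (addrI t0)).
- by move=> b; rewrite mem_filter => /andP[_]; exact: (sim_jobs sim).
- by rewrite hist_advance (negbTE todo) x_up.
- by left.
Qed.

Lemma sim_advance_hidden : x \notin upcoming IS cfg' w ->
  simulates t0 S C cfg2 cfg'.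
Proof.
move=> x_up.
have D0 : newly_completed I cfg (t0 + x) = fset0.
  rewrite (sim_newly_completed sim); apply/eqP/fset0Pn => -[j jD].
  case/negP: x_up; apply/(sim_visible sim); rewrite negb_and; apply/orP; left.
  rewrite /nilp size_map -lt0n -has_predT; apply/hasP; exists j => //.
have completed2 : completed cfg2 = completed cfg.
  by rewrite -[RHS]fsetU0 -D0.
have running2 : running cfg2 = running cfg.
  apply/all_filterP/allP => b br; apply: contraNneq x_up => bx.
  move: br bx; rewrite (sim_run sim) => /mapP[b' b'r ->] /= /addrI bx.
  by apply/mem_upcoming/Or42; exists b'.
split=> //; rewrite ?completed2 ?running2.
- by apply: fsubset_trans (sim_sub sim) _; exact: fsubsetUl.
- exact: (sim_old sim).
- exact: (sim_rel sim).
- exact: (sim_comp sim).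
- exact: (sim_run sim).
- exact: (sim_jobs sim).
- rewrite hist_advance completed2 (negbTE (sim_todo sim)) (negbTE x_up) //.
- exact: (sim_todo sim).
(* The real clock runs ahead of that of [A] here; harmless, because [A] is still waiting with the
   same [w] and no event of its run has been passed. *)
right; exists w; split=> //.
- apply: le_trans now_x; case: (sim_now sim) => [->//|[w0 []//]].
- by move=> u uu; move/allP: x_min; apply; apply/(sim_mem_upcoming sim); left; exists u.
Qed.

(** A batch still running would end strictly later, with all its jobs in [S] and thus completed,
    against [running_unfinished]. *)
Lemma between_advance : S `\` completed cfg2 = fset0 -> between cfg2.
Proof.
move=> S0; split=> //; last by rewrite hist_advance S0 eqxx.
have [_ late] := wf_advance (sim_wf sim) now_x x_min.
case r2E: (running cfg2) => [//|b r2]; exfalso.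
have br : b \in running cfg2 by rewrite r2E mem_head.
have /negP[] := running_unfinished wf2 br (late b br).
have : S `<=` completed cfg2 by rewrite -fsetD_eq0 S0.
apply: fsubset_trans; move: br; rewrite mem_filter => /andP[_].
by rewrite (sim_run sim) => /mapP[b' b'r ->]; exact: (sim_jobs sim b'r).
Qed.

End Advance.
End Simulation.

(** * Competitiveness *)

Section Runs.
Context {R : realType} {m : nat}.
Implicit Types (b : batch R m) (x : R) (w : option R) (I : instance R).
Implicit Types (cfg : config R m) (S C : {fset nat}) (st : setting).

Lemma step_now st I (A : algorithm R m) cfg cfg' :
  step st I A cfg cfg' -> now cfg <= now cfg'.
Proof.
rewrite /step; case: (A _ _) => [X M|i|w].
- by case=> _ [b [_ _ _ _ ->]].
- by case=> _ [r1 [b [r2 [b' [_ _ _ _ ->]]]]].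
- by case=> x [nx _ _ ->].
Qed.

(** Time never decreases, so the bound on the final time holds at every configuration on the way, in
    particular when the last job of [S] is completed. *)
Lemma finishes_now st I (A : algorithm R m) B cfg :
  finishes_by st I A B cfg -> now cfg <= B.
Proof.
elim=> // {}cfg [cfg' stp] _ IH.
exact: le_trans (step_now stp) (IH _ stp).
Qed.

Lemma seq_min (s : seq R) : s != [::] ->
  exists2 x, x \in s & all (fun y => x <= y) s.
Proof.
elim: s => // y s IHs _; have [->|/IHs[x xs xmin]] := eqVneq s [::].
  by exists y; rewrite ?mem_head //= lexx.
have [yx|xy] := leP y x.
  exists y; rewrite ?mem_head //= lexx; apply/allP => z zs.
  by apply: le_trans yx _; exact: (allP xmin).
by exists x; rewrite ?inE ?xs ?orbT //= (ltW xy).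
Qed.

Lemma step_wait st I (A : algorithm R m) cfg w :
    A (known_setup I cfg) (hist cfg) = Wait w ->
    upcoming I cfg w != [::] ->
    (forall x, x \in upcoming I cfg w -> now cfg <= x) ->
  exists cfg', step st I A cfg cfg'.
Proof.
move=> AW /seq_min[x xu xmin] up; exists (advance I cfg w x).
by rewrite /step AW; exists x; split=> //; exact: up.
Qed.

Section Subschedule.
Variables (st : setting) (I : instance R) (A : algorithm R m).
Hypothesis uI : uets_instance I.
Variables (t0 : R) (S C : {fset nat}).
Let IS := subinstance I S.

Lemma sim_start h h' cfg cfg' b : simulates I A t0 S C cfg cfg' ->
    can_start st cfg' (bjobs b) (bmach b) -> completed_execution I b ->
    foldr ignore_update None h =
      Some (Subschedule t0 S (S `\` completed cfg)
            (released cfg `\` (S `|` completed cfg)) h') ->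
    now cfg = t0 + now cfg' ->
  can_start st cfg (bjobs b) (bmach b) /\
  simulates I A t0 S C
    (Config (now cfg) h (released cfg) (completed cfg) (shift t0 b :: running cfg))
    (Config (now cfg') h' (released cfg') (completed cfg') (b :: running cfg')).
Proof.
move=> sim can cb hE nE; have cs : can_start st cfg (bjobs b) (bmach b).
  case/and5P: can => shp; rewrite (sim_rel sim) (sim_comp sim) => XS XC XR MR.
  apply/and5P; split=> //.
  - exact: fsubset_trans XS (sim_sub sim).
  - apply/fdisjointP => j jX; have := fdisjointP XC _ jX.
    by rewrite in_fsetI (fsubsetP XS _ jX) andbT.
  - by rewrite (sim_run sim) all_map.
  - by rewrite (sim_run sim) all_map.
split=> //; split=> //=.
- exact: (wf_start (b := shift t0 b) _ uI (sim_wf sim) cs (shift_completed t0 cb)).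
- exact: sim_sub sim.
- exact: sim_old sim.
- exact: sim_rel sim.
- exact: sim_comp sim.
- by rewrite (sim_run sim).
- move=> b'; rewrite inE => /predU1P[->|]; last exact: (sim_jobs sim).
  by case/and5P: can; rewrite (sim_rel sim).
- exact: sim_todo sim.
- by left.
Qed.

Lemma sim_halt h h' cfg cfg' r1 b r2 b' : simulates I A t0 S C cfg cfg' ->
    running cfg' = r1 ++ b :: r2 -> halted_execution I (now cfg') b b' ->
    foldr ignore_update None h =
      Some (Subschedule t0 S (S `\` completed cfg)
            (released cfg `\` (S `|` completed cfg)) h') ->
    now cfg = t0 + now cfg' ->
  simulates I A t0 S C
    (Config (now cfg) h (released cfg) (completed cfg)
       (map (shift t0) r1 ++ shift t0 b' :: map (shift t0) r2))
    (Config (now cfg') h' (released cfg') (completed cfg') (r1 ++ b' :: r2)).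
Proof.
move=> sim rE hb hE nE; split=> //=.
- apply: (wf_halt _ (sim_wf sim) (b := shift t0 b)).
    by rewrite (sim_run sim) rE map_cat.
  by rewrite nE; exact: shift_halted.
- exact: sim_sub sim.
- exact: sim_old sim.
- exact: sim_rel sim.
- exact: sim_comp sim.
- by rewrite map_cat.
- move=> b1; rewrite mem_cat inE orbCA => /predU1P[->|b1r].
    have -> : bjobs b' = bjobs b by case: hb => X' [-> _ _ _ _].
    by apply: (sim_jobs sim); rewrite rE mem_cat inE eqxx orbT.
  by apply: (sim_jobs sim); rewrite rE mem_cat inE orbCA b1r orbT.
- exact: sim_todo sim.
- by left.
Qed.

Lemma sim_now_eq cfg cfg' : simulates I A t0 S C cfg cfg' ->
    (forall w, A (known_setup IS cfg') (hist cfg') <> Wait w) ->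
  now cfg = t0 + now cfg'.
Proof. by move=> sim noW; case: (sim_now sim) => [//|[w [/noW]]]. Qed.

Lemma sim_hist_cons cfg cfg' e : simulates I A t0 S C cfg cfg' ->
    now cfg = t0 + now cfg' ->
    (if e is Observed _ _ _ _ then false else true) ->
  foldr ignore_update None ((now cfg, e) :: hist cfg) =
    Some (Subschedule t0 S (S `\` completed cfg)
      (released cfg `\` (S `|` completed cfg)) ((now cfg', e) :: hist cfg')).
Proof.
move=> sim nE; rewrite /= (sim_hist sim) nE [t0 + _ - _]addrC addKr.
by case: e.
Qed.

(** An outcome for [A], shifted forward, gives progress; an arbitrary outcome for [ignore A],
    shifted back, is one that the induction hypothesis covers. Preemption is handled in the same
    way. *)
Lemma sim_step_start cfg cfg' X M B :
    simulates I A t0 S C cfg cfg' ->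
    A (known_setup IS cfg') (hist cfg') = Start X M ->
    (exists cfg'', step st IS A cfg' cfg'') ->
    (forall cfg2', step st IS A cfg' cfg2' -> forall cfg2,
      simulates I A t0 S C cfg2 cfg2' -> finishes_by st I (ignore A) B cfg2) ->
  finishes_by st I (ignore A) B cfg.
Proof.
move=> sim AE ex IH; have igE := ignore_command sim; rewrite AE in igE.
have nE : now cfg = t0 + now cfg' by apply: sim_now_eq sim _ => w; rewrite AE.
have hE := sim_hist_cons sim nE (e := Started X M) isT.
case: ex => ?; rewrite /step AE => -[can [b0 [cb0 jE ME bs _]]].
have sub b : completed_execution I b -> bjobs b = X -> bmach b = M ->
    can_start st cfg X M /\ simulates I A t0 S C
      (Config (now cfg) ((now cfg, Started X M) :: hist cfg) (released cfg)
        (completed cfg) (shift t0 b :: running cfg))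
      (Config (now cfg') ((now cfg', Started X M) :: hist cfg') (released cfg')
        (completed cfg') (b :: running cfg')).
  move=> cb bX bM; have canb : can_start st cfg' (bjobs b) (bmach b).
    by rewrite bX bM.
  by have := sim_start sim canb cb hE nE; rewrite bX bM.
apply: StepBy => [|cfg2].
  rewrite /step igE; have [can' _] := sub b0 cb0 jE ME.
  eexists; split=> //; exists (shift t0 b0); split=> //.
  - exact: shift_completed.
  - by rewrite nE /= bs.
rewrite /step igE => -[_ [b [cb bX bM bs' ->]]].
have cb' := shift_completed (- t0) cb.
have [_ sim'] := sub (shift (- t0) b) cb' bX bM.
rewrite shiftVK in sim'; apply: IH sim'.
rewrite /step AE; split=> //; exists (shift (- t0) b); split=> //.
by rewrite /= bs' nE addKr.
Qed.

Lemma sim_step_preempt cfg cfg' i B :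
    simulates I A t0 S C cfg cfg' ->
    A (known_setup IS cfg') (hist cfg') = Preempt i ->
    (exists cfg'', step st IS A cfg' cfg'') ->
    (forall cfg2', step st IS A cfg' cfg2' -> forall cfg2,
      simulates I A t0 S C cfg2 cfg2' -> finishes_by st I (ignore A) B cfg2) ->
  finishes_by st I (ignore A) B cfg.
Proof.
move=> sim AE ex IH; have igE := ignore_command sim; rewrite AE in igE.
have nE : now cfg = t0 + now cfg' by apply: sim_now_eq sim _ => w; rewrite AE.
have hE := sim_hist_cons sim nE (e := Preempted i) isT.
case: ex => ?; rewrite /step AE => -[pre [r1 [b [r2 [b' [rE ib nh hb _]]]]]].
apply: StepBy => [|cfg2].
  rewrite /step igE; eexists; split=> //.
  exists (map (shift t0) r1), (shift t0 b), (map (shift t0) r2), (shift t0 b').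
  split=> //; first by rewrite (sim_run sim) rE map_cat.
  by rewrite nE; exact: shift_halted.
rewrite /step igE => -[_ {r1 b r2 b' rE ib nh hb}[r1 [b [r2 [b' [rE ib nh hb ->]]]]]].
have unshift s : map (shift t0) (map (shift (- t0)) s) = s.
  by rewrite mapK //; exact: shiftVK.
have rE' : running cfg' =
    map (shift (- t0)) r1 ++ shift (- t0) b :: map (shift (- t0)) r2.
  rewrite -map_cons -map_cat -rE (sim_run sim) mapK //; exact: shiftK.
have hb' : halted_execution I (now cfg') (shift (- t0) b) (shift (- t0) b').
  by have := shift_halted (- t0) hb; rewrite nE addKr.
have sim' := sim_halt sim rE' hb' hE nE.
rewrite !unshift shiftVK in sim'; apply: IH sim'.
rewrite /step AE; split=> //; exists (map (shift (- t0)) r1), (shift (- t0) b).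
by exists (map (shift (- t0)) r2), (shift (- t0) b').
Qed.

Lemma sim_step_wait cfg' w B B' :
    A (known_setup IS cfg') (hist cfg') = Wait w ->
    (exists cfg'', step st IS A cfg' cfg'') ->
    (forall cfg2', step st IS A cfg' cfg2' -> now cfg2' <= B') ->
    (forall cfg2', step st IS A cfg' cfg2' -> forall cfg2,
      simulates I A t0 S C cfg2 cfg2' -> finishes_by st I (ignore A) B cfg2) ->
    (forall cfg, between I cfg -> C `<=` completed cfg -> S `<=` completed cfg ->
      now cfg <= t0 + B' -> finishes_by st I (ignore A) B cfg) ->
  forall cfg, simulates I A t0 S C cfg cfg' -> finishes_by st I (ignore A) B cfg.
Proof.
move=> AE ex le_B' IH Hend cfg.
case: ex => ?; rewrite /step AE => -[x0 [nx0 x0up /allP x0min _]].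
(* Hidden releases leave [cfg'] in place, so the hypothesis [IH] does not apply after them; each one
   lowers the number of unreleased jobs instead. *)
have [n] := ubnP #|` jobs I `\` released cfg|; elim: n cfg => // n IHn cfg lt_n sim.
have igE := ignore_command sim; rewrite AE in igE.
have sim_le u : u \in upcoming IS cfg' w -> now cfg <= t0 + u.
  case: (sim_now sim) => [-> uu|[w0 [AE0 _ le]]].
    by rewrite lerD2l (le_trans nx0) // x0min.
  by move: AE0; rewrite -/IS AE => -[ww0]; rewrite ww0; exact: le.
apply: StepBy => [|cfg2].
  apply: step_wait igE _ _.
    have : t0 + x0 \in upcoming I cfg (omap (+%R t0) w).
      by apply/(sim_mem_upcoming sim); left; exists x0.
    by case: upcoming.
  move=> x /(sim_mem_upcoming sim)[[u uu ->]|[j]]; first exact: sim_le.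
  rewrite in_fsetD => /andP[jr jI] <-; exact: (wf_new (sim_wf sim)).
rewrite /step igE => -[y [ny yup ymin ->]].
have [x yE] : exists x, y = t0 + x by exists (- t0 + y); rewrite addNKr.
rewrite {}yE in ny yup ymin *.
have [xup|xup] := boolP (x \in upcoming IS cfg' w); last first.
  have sim2 := sim_advance_hidden sim AE ny ymin xup.
  apply: IHn sim2; rewrite ltnS in lt_n; apply: leq_trans lt_n.
  case/(sim_mem_upcoming sim): yup => [[u uu /addrI xu]|[j jr jx]].
    by rewrite xu uu in xup.
  apply: fproper_ltn_card; rewrite fproperE; apply/andP; split.
    by apply/fsubsetP => i; rewrite !in_fsetD in_fsetU negb_or => /andP[/andP[-> _] ->].
  apply/fsubsetPn; exists j => //; move: jr; rewrite in_fsetD => /andP[jr jI].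
  by rewrite !inE jI jr jx eqxx orbT.
(* A minimum over all events on [I] that is attained at an event of [A] is also the minimum over the
   events of [A]. *)
have stp : step st IS A cfg' (advance IS cfg' w x).
  rewrite /step AE; exists x; split=> //.
    by apply: le_trans nx0 _; exact: x0min.
  apply/allP => u uu; rewrite -(lerD2l t0); apply: (allP ymin).
  by apply/(sim_mem_upcoming sim); left; exists u.
have [S0|Sn0] := eqVneq (S `\` completed (advance I cfg (omap (+%R t0) w) (t0 + x))) fset0.
  apply: Hend.
  - exact: (between_advance sim ny ymin S0).
  - by apply: fsubset_trans (sim_old sim) _; exact: fsubsetUl.
  - by rewrite -fsetD_eq0 S0.
  - by rewrite /= lerD2l; exact: le_B' stp.
exact: (IH _ stp _ (sim_advance sim ny ymin xup Sn0)).
Qed.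

Lemma subschedule_finishes B B' cfg' :
    finishes_by st IS A B' cfg' ->
    (forall cfg, between I cfg -> C `<=` completed cfg -> S `<=` completed cfg ->
      now cfg <= t0 + B' -> finishes_by st I (ignore A) B cfg) ->
  forall cfg, simulates I A t0 S C cfg cfg' -> finishes_by st I (ignore A) B cfg.
Proof.
move=> fin Hend; elim: fin => {}cfg'.
  (* No simulated configuration has [S] completed: the run leaves the simulation, through [Hend], at
     the very observation that completes [S]. *)
  rewrite /finished /= => Sfin _ cfg sim; case/eqP: (sim_todo sim).
  apply/eqP; rewrite fsetD_eq0; apply: fsubset_trans Sfin _.
  by rewrite (sim_comp sim) fsubsetIl.
move=> ex fin IH cfg sim; case AE : (A (known_setup IS cfg') (hist cfg')) => [X M|i|w].
- exact: sim_step_start sim AE ex IH.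
- exact: sim_step_preempt sim AE ex IH.
- apply: sim_step_wait AE ex _ IH Hend _ sim => cfg2' /fin; exact: finishes_now.
Qed.

End Subschedule.

End Runs.

Section Ratio.
Context {R : realType} {m : nat}.
Implicit Types (I : instance R) (cfg : config R m) (st : setting).

Lemma rtime_le_opt st I j : (0 < m)%N -> uets_instance I ->
  j \in jobs I -> rtime I j <= opt m st I.
Proof.
move=> m0 uI jI; apply: le_trans (rtime_ptime_le_opt st m0 uI jI).
by rewrite lerDl; case: uI => _ _ _ + _; apply.
Qed.

Lemma opt_ge0 st I : (0 < m)%N -> uets_instance I -> 0 <= opt m st I.
Proof.
move=> m0 uI; apply: lb_le_inf => [|_ [sigma _ <-]]; last exact: makespan_ge0.
by have [sigma os] := exists_offline_schedule st m0 uI; exists (makespan sigma), sigma.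
Qed.

(** Runs start at time 0, so [rho] times the optimum is nonnegative; a unit job without setup has
    optimum at least 1. *)
Lemma competitive_ratio_ge0 st (A : algorithm R m) rho : (0 < m)%N ->
  competitive_at_0 st A rho -> 0 <= rho.
Proof.
move=> m0 compA.
pose U : instance R := Instance [fset 0%N] (fun=> 0) (fun=> 1) (fun=> 0).
have uU : uets_instance U.
  by split=> [?|?|? ? ? ? ?|? ?|? ?] //=; rewrite ?addr0 ?ler01.
have := finishes_now (compA U uU (fun _ _ => erefl)); rewrite /= pmulr_lge0 //.
apply: lt_le_trans (_ : 0 + 1 <= _); first by rewrite add0r ltr01.
by apply: (rtime_ptime_le_opt st m0 uU (j := 0%N)); rewrite inE.
Qed.

Lemma between_init I : uets_instance I -> between I (init I : config R m).
Proof.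
move=> [_ _ _ _ r0]; split=> //=; last by rewrite fsetD0.
split=> //=.
- by apply/fsubsetP => j; rewrite !inE => /andP[].
- by move=> j jI _; exact: r0.
Qed.

Lemma sim_init I (A : algorithm R m) cfg (S := released cfg `\` completed cfg) :
    between I cfg -> S != fset0 ->
  simulates I A (now cfg) S (completed cfg) cfg (init (subinstance I S)).
Proof.
move=> bt S0; have initS : [fset j in S | (0 : R) == 0] = S.
  by apply/fsetP => j; rewrite !inE eqxx andbT.
have SD : S `\` completed cfg = S by rewrite /S fsetDDl fsetUid.
split=> //=; rewrite ?initS //.
- exact: between_wf bt.
- exact: fsubsetDl.
- by apply/fsetP => j; rewrite !inE; case: (j \in completed cfg); rewrite ?andbF.
- exact: between_idle bt.
- rewrite (between_hist bt) /begin_subschedule -/S (negbTE S0) SD.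
  congr (Some (Subschedule _ _ _ _ _)); apply/esym/eqP.
  rewrite fsetD_eq0; apply/fsubsetP => j jr; rewrite !inE jr andbT.
  by case: (_ \in _).
- by rewrite SD.
- by left; rewrite addr0.
Qed.

(** The sharper bound on [now cfg] is asked only if a subschedule is about to begin; with nothing
    left to do, the last subschedule may have ended as late as [B]. *)
Lemma between_finishes st I (A : algorithm R m) rho (B := (2 * rho + 1) * opt m st I) :
    (0 < m)%N -> uets_instance I -> competitive_at_0 st A rho ->
  forall cfg, between I cfg -> now cfg <= B ->
    (released cfg `\` completed cfg != fset0 ->
       now cfg <= opt m st I + rho * opt m st I) ->
  finishes_by st I (ignore A) B cfg.
Proof.
move=> m0 uI compA cfg.
have rho0 := competitive_ratio_ge0 m0 compA; have opt0 := opt_ge0 st m0 uI.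
have ropt0 : 0 <= rho * opt m st I by rewrite mulr_ge0.
have BE : B = opt m st I + rho * opt m st I + rho * opt m st I.
  by rewrite /B mulrDl mul1r -mulrA mulr_natl mulr2n addrC addrA.
have [n] := ubnP #|` jobs I `\` completed cfg|; elim: n cfg => // n IHn cfg0 lt_n0.
(* Stated for the same [n] as the goal: idle waiting completes no job, so [IHn] is out of reach
   after it, whereas a nonempty subschedule lowers the number of uncompleted jobs. *)
have busy cfg : (#|` jobs I `\` completed cfg| < n.+1)%N -> between I cfg ->
    now cfg <= opt m st I + rho * opt m st I ->
    released cfg `\` completed cfg != fset0 -> finishes_by st I (ignore A) B cfg.
  rewrite ltnS => lt_n bt now_le S0.
  set S := released cfg `\` completed cfg in S0.
  have wf := between_wf bt.
  have SI : S `<=` jobs I := fsubset_trans (fsubsetDl _ _) (wf_rel wf).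
  have finS := compA _ (uets_subinstance uI SI) (fun _ _ => erefl).
  have roptS : rho * opt m st (subinstance I S) <= rho * opt m st I.
    by rewrite ler_wpM2l // opt_subinstance.
  apply: (subschedule_finishes uI finS _ (sim_init A bt S0)) => cfg2 bt2 C2 S2 now2.
  have {}now2 : now cfg2 <= now cfg + rho * opt m st I.
    by apply: le_trans now2 _; rewrite lerD2l.
  apply: (IHn cfg2 _ bt2).
  - apply: leq_trans lt_n; apply: fproper_ltn_card; rewrite fproperE.
    rewrite fsetDS //=; case/fset0Pn: S0 => j jS; apply/fsubsetPn; exists j.
      rewrite in_fsetD (fsubsetP SI _ jS) andbT.
      by move: jS; rewrite in_fsetD => /andP[].
    by rewrite in_fsetD (fsubsetP S2 _ jS).
  - by apply: le_trans now2 _; rewrite BE lerD2r.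
  - case/fset0Pn=> j; rewrite in_fsetD => /andP[jC2 jr2].
    have jI : j \in jobs I by apply: (fsubsetP (wf_rel (between_wf bt2))).
    apply: le_trans now2 _; rewrite lerD2r.
    apply: le_trans (rtime_le_opt st m0 uI jI); apply: (wf_new wf jI).
    (* A job released by the start of this subschedule was completed before it or belongs to [S];
       [C2] records that the former stay completed. *)
    apply: contra jC2 => jr; have [jC|jC] := boolP (j \in completed cfg).
      exact: (fsubsetP C2).
    by apply: (fsubsetP S2); rewrite in_fsetD jC.
move=> bt now_B now_le.
have [S0|Sn0] := eqVneq (released cfg0 `\` completed cfg0) fset0; last first.
  by apply: busy => //; exact: now_le.
have [fin|nfin] := boolP (finished I cfg0); first exact: FinishedBy.
have wf := between_wf bt.
have igE : ignore A (known_setup I cfg0) (hist cfg0) = Wait None.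
  by rewrite /ignore (between_hist bt) S0 /begin_subschedule eqxx.
have up x : x \in upcoming I cfg0 None <->
    exists2 j, j \in jobs I `\` released cfg0 & rtime I j = x.
  split=> [/mem_upcoming[[b]|[b]|//|//]|?]; last exact/mem_upcoming/Or43.
    by rewrite (between_idle bt).
  by rewrite (between_idle bt).
have RC : released cfg0 `<=` completed cfg0 by rewrite -fsetD_eq0 S0.
apply: StepBy => [|cfg1].
  apply: step_wait igE _ _ => [|x /up[j + <-]]; last first.
    by rewrite in_fsetD => /andP[jr jI]; exact: wf_new.
  case/fsubsetPn: nfin => j jI jC.
  have : rtime I j \in upcoming I cfg0 None.
    by apply/up; exists j; rewrite // in_fsetD jI andbT (contraNN (fsubsetP RC j)).
  by case: upcoming.
rewrite /step igE => -[x [nx xup xmin ->]].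
have [wf1 _] := wf_advance wf nx xmin.
have [j jIr jx] := (up x).1 xup.
have D0 : newly_completed I cfg0 x = fset0.
  apply/eqP/fset0Pn => -[i /mem_newly_completed[_ _ [b]]].
  by rewrite (between_idle bt).
have completed1 : completed (advance I cfg0 None x) = completed cfg0.
  by rewrite -[RHS]fsetU0 -D0.
have [jr jI] : j \notin released cfg0 /\ j \in jobs I.
  by move: jIr; rewrite in_fsetD => /andP[].
(* Idle machines are woken only by a release, hence not after the optimum. *)
have xo : x <= opt m st I by rewrite -jx rtime_le_opt.
apply: busy.
- by rewrite completed1.
- split=> //; first by rewrite /= (between_idle bt).
  rewrite completed1 /= (between_hist bt) S0 {1}/begin_subschedule eqxx /=.
  congr (begin_subschedule _ _); rewrite fsetDUl S0 fset0U; apply/esym/fsetDidPl.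
  apply/fdisjointP => i; rewrite !inE => /and3P[_ ir _].
  exact: contraNN (fsubsetP (wf_fin wf) i) ir.
- by apply: le_trans xo _; rewrite lerDl.
- apply/fset0Pn; exists j; rewrite completed1 in_fsetD.
  rewrite (contraNN (fsubsetP (wf_fin wf) j) jr) in_fsetU !inE jI jr jx eqxx.
  by rewrite orbT.
Qed.

End Ratio.

Theorem theorem1 (R : realType) (m : nat) (hm : (2 <= m)%N) (st : setting)
    (ALG : algorithm R m) (rho : R) :
  competitive_at_0 st ALG rho -> competitive st (ignore ALG) (2 * rho + 1).
Proof.
move=> compA I uI _; have m0 : (0 < m)%N := ltnW hm.
have rho0 := competitive_ratio_ge0 m0 compA; have opt0 := opt_ge0 st m0 uI.
apply: (between_finishes m0 uI compA (between_init uI)) => [|_] /=.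
  by rewrite mulr_ge0 // addr_ge0 // mulr_ge0.
by rewrite addr_ge0 // mulr_ge0.
Qed.
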